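(* Let $\mathcal{N}\to\mathcal{E}\xrightarrow{j}\mathcal{G}$ be a groupoid extension and let $R$ be a unital ring. Let $k:\mathcal{G}\to\mathcal{E}$ be a normalized section for $j$, let $(L,\sigma)$ be the associated factor system for $(\mathcal{G},\mathcal{N})$, and let $(M,\tau)$ be the factor system for $(\mathcal{G},R[\mathcal{N}])$ associated with $R$ and $(L,\sigma)$. Then the groupoid crossed product $R[\mathcal{N}]\times_{(M,\tau)}\mathcal{G}$ is isomorphic (as a ring) to the groupoid ring $R[\mathcal{E}]$.
   Context: Groupoids are purely algebraic (no topology). A groupoid $\mathcal{G}$ has unit space $\mathcal{G}^{(0)}\subseteq\mathcal{G}$ and range and source maps $r,s$; $xy$ is defined iff $s(x)=r(y)$; $\mathcal{G}^{(2)}$ is the set of composable pairs. A group bundle over $\mathcal{G}^{(0)}$ is a set $\mathcal{N}$ with a map $p:\mathcal{N}\to\mathcal{G}^{(0)}$ whose fibres $N_u$ are groups; it is a groupoid over $\mathcal{G}^{(0)}$ (identify the identity of $N_u$ with $u$; $r=s=p$). Extension. A groupoid extension $\mathcal{N}\to\mathcal{E}\xrightarrow{j}\mathcal{G}$ is a surjective groupoid homomorphism $j:\mathcal{E}\to\mathcal{G}$, where $\mathcal{E}$ is a groupoid with unit space $\mathcal{G}^{(0)}$, $j$ is the identity on $\mathcal{G}^{(0)}$, and $\mathcal{N}=\{e\in\mathcal{E}: j(e)\in\mathcal{G}^{(0)}\}$. A normalized section is a map $k:\mathcal{G}\to\mathcal{E}$ with $j\circ k=\mathrm{id}_{\mathcal{G}}$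 and $k|_{\mathcal{G}^{(0)}}=\mathrm{id}$. Its associated factor system $(L,\sigma)$ consists of the group isomorphisms $L_x:N_{s(x)}\to N_{r(x)}$, $L_x(n)=k(x)nk(x)^{-1}$, and the map $\sigma:\mathcal{G}^{(2)}\to\mathcal{N}$, $\sigma(x,y)\in N_{r(x)}$, determined by $k(x)k(y)=\sigma(x,y)k(xy)$. Rings. The groupoid ring $R[\mathcal{E}]$ is the set of finitely supported functions $f:\mathcal{E}\to R$ with pointwise addition and product $(fg)(z)=\sum_{xy=z}f(x)g(y)$. $R[\mathcal{N}]$ here denotes the ring bundle $\bigcup_{u\in\mathcal{G}^{(0)}}R[N_u]$ over $\mathcal{G}^{(0)}$ whose fibre at $u$ is the group ring $R[N_u]$ (finitely supported functions $N_u\to R$ with convolution). The factor system $(M,\tau)$ associated with $R$ and $(L,\sigma)$ is given by $M_x:R[N_{s(x)}]\to R[N_{r(x)}]$, $M_x(f)=f\circ L_x^{-1}$, for $x\in\mathcal{G}$, and $\tau(x,y)=\delta_{\sigma(x,y)}\in R[N_{r(x)}]^\times$ (the characteristic function of $\{\sigma(x,y)\}$) for $(x,y)\in\mathcal{G}^{(2)}$. The crossed product $R[\mathcal{N}]\times_{(M,\tau)}\mathcal{G}$ is the ring of finitely supported functions $f$ on $\mathcal{G}$ with $f(x)\in R[N_{r(x)}]$, with pointwise sum and product $(fg)(z)=\sum_{xy=z}f(x)M_x(g(y))\tau(x,y)$. *)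

(* Defs.v *)
From HB Require Import structures.
From mathcomp Require Import all_boot all_algebra.
From mathcomp Require Import all_classical.

Set Implicit Arguments.
Unset Strict Implicit.
Unset Printing Implicit Defensive.

Import GRing.Theory.
Local Open Scope classical_set_scope.
Local Open Scope ring_scope.

(* A groupoid with unit space U.  [hom u v] is the set of arrows x with
   r(x) = u and s(x) = v, so that [comp x y] = xy typechecks exactly when
   s(x) = r(y); the unit u of U is identified with the arrow [gid u]. *)
Record groupoid (U : Type) := Groupoid {
  hom :> U -> U -> Type;
  gid : forall u, hom u u;
  comp : forall u v w, hom u v -> hom v w -> hom u w;
  ginv : forall u v, hom u v -> hom v u;
  compA : forall u v w t (x : hom u v) (y : hom v w) (z : hom w t),
    comp x (comp y z) = comp (comp x y) z;
  comp1x : forall u v (x : hom u v), comp (gid u) x = x;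
  compx1 : forall u v (x : hom u v), comp x (gid v) = x;
  compVx : forall u v (x : hom u v), comp (ginv x) x = gid v;
  compxV : forall u v (x : hom u v), comp x (ginv x) = gid u }.

Arguments gid {U g} u.
Arguments comp {U g u v w} x y.
Arguments ginv {U g u v} x.

Record arrow (U : Type) (G : groupoid U) := Arrow {
  range : U;
  source : U;
  arrow_hom : G range source }.

Arguments Arrow {U G range source} arrow_hom.

Definition factorizations (U : Type) (G : groupoid U) (u w : U) (z : G u w) :
    set {classic {v : U & (G u v * G v w)%type}} :=
  [set p | comp (projT2 p).1 (projT2 p).2 = z].

(* The two groupoids of an extension share the unit space U, and the extension
   map is the identity on U since it maps E u v to G u v. *)
Record groupoid_extension (U : Type) (E G : groupoid U) := GroupoidExtension {
  ext_map :> forall u v, E u v -> G u v;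
  ext_comp : forall u v w (x : E u v) (y : E v w),
    ext_map (comp x y) = comp (ext_map x) (ext_map y);
  ext_surj : forall u v (x : G u v), exists e : E u v, ext_map e = x }.

Arguments ext_map {U E G} j {u v} e : rename.

Record normalized_section (U : Type) (E G : groupoid U)
    (j : groupoid_extension E G) := NormalizedSection {
  sec :> forall u v, G u v -> E u v;
  secK : forall u v (x : G u v), ext_map j (sec x) = x;
  sec_gid : forall u, sec (gid u) = gid u }.

Arguments sec {U E G j} k {u v} x : rename.

Section GroupoidTheory.
Variables (U : Type) (G : groupoid U).

Lemma compVK u v w (x : G u v) (y : G v w) : comp (ginv x) (comp x y) = y.
Proof. by rewrite compA compVx comp1x. Qed.

Lemma compKV u v w (x : G v u) (y : G v w) : comp x (comp (ginv x) y) = y.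
Proof. by rewrite compA compxV comp1x. Qed.

Lemma compI u v w (x : G u v) (y y' : G v w) : comp x y = comp x y' -> y = y'.
Proof. by move=> e; rewrite -(compVK x y) e compVK. Qed.

Lemma ginv_gid u : ginv (gid u : G u u) = gid u.
Proof. by apply: (@compI _ _ _ (gid u)); rewrite compxV comp1x. Qed.

End GroupoidTheory.

Section ExtensionTheory.
Variables (U : Type) (E G : groupoid U) (j : groupoid_extension E G).

Lemma ext_gid u : ext_map j (gid u) = gid u.
Proof.
apply: (@compI _ _ _ _ _ (ext_map j (gid u))).
by rewrite -ext_comp comp1x compx1.
Qed.

Lemma ext_ginv u v (x : E u v) : ext_map j (ginv x) = ginv (ext_map j x).
Proof.
apply: (@compI _ _ _ _ _ (ext_map j x)).
by rewrite -ext_comp !compxV ext_gid.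
Qed.

End ExtensionTheory.

(* The fibre N_u = {e in E : j(e) = u} of the kernel bundle; j(e) = u forces
   r(e) = s(e) = u. *)
Record fibre (U : Type) (E G : groupoid U) (j : groupoid_extension E G)
    (u : U) := Fibre {
  fibre_val :> E u u;
  fibreP : ext_map j fibre_val = gid u }.

Section FibreGroup.
Variables (U : Type) (E G : groupoid U) (j : groupoid_extension E G) (u : U).

Lemma fibre_inj (n m : fibre j u) : fibre_val n = fibre_val m -> n = m.
Proof.
by case: n m => [n hn] [m hm] /= e; subst m; congr Fibre; exact: Prop_irrelevance.
Qed.

Lemma fibre_oneP : ext_map j (gid u) = gid u. Proof. exact: ext_gid. Qed.

Lemma fibre_mulP (n m : fibre j u) : ext_map j (comp n m) = gid u.
Proof. by rewrite ext_comp !fibreP comp1x. Qed.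

Lemma fibre_invP (n : fibre j u) : ext_map j (ginv n) = gid u.
Proof. by rewrite ext_ginv fibreP ginv_gid. Qed.

Definition fibre_one := Fibre fibre_oneP.
Definition fibre_mul n m := Fibre (fibre_mulP n m).
Definition fibre_inv n := Fibre (fibre_invP n).

Lemma fibre_mulA : associative fibre_mul.
Proof. by move=> x y z; apply/fibre_inj/compA. Qed.

Lemma fibre_mul1 : left_id fibre_one fibre_mul.
Proof. by move=> x; apply/fibre_inj/comp1x. Qed.

Lemma fibre_mulr1 : right_id fibre_one fibre_mul.
Proof. by move=> x; apply/fibre_inj/compx1. Qed.

Lemma fibre_mulV : left_inverse fibre_one fibre_inv fibre_mul.
Proof. by move=> x; apply/fibre_inj/compVx. Qed.

Lemma fibre_mulrV : right_inverse fibre_one fibre_inv fibre_mul.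
Proof. by move=> x; apply/fibre_inj/compxV. Qed.

HB.instance Definition _ := gen_eqMixin (fibre j u).
HB.instance Definition _ := gen_choiceMixin (fibre j u).
HB.instance Definition _ := isGroup.Build (fibre j u)
  fibre_mulA fibre_mul1 fibre_mulr1 fibre_mulV fibre_mulrV.

End FibreGroup.

Section FactorSystem.
Variables (U : Type) (E G : groupoid U) (j : groupoid_extension E G).
Variable k : normalized_section j.

Lemma fs_LP u v (x : G u v) (n : fibre j v) :
  ext_map j (comp (comp (sec k x) n) (ginv (sec k x))) = gid u.
Proof. by rewrite !ext_comp fibreP ext_ginv secK compx1 compxV. Qed.

Definition fs_L u v (x : G u v) (n : fibre j v) : fibre j u := Fibre (fs_LP x n).

Lemma fs_LinvP u v (x : G u v) (n : fibre j u) :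
  ext_map j (comp (comp (ginv (sec k x)) n) (sec k x)) = gid v.
Proof. by rewrite !ext_comp fibreP ext_ginv secK compx1 compVx. Qed.

Definition fs_Linv u v (x : G u v) (n : fibre j u) : fibre j v :=
  Fibre (fs_LinvP x n).

Lemma fs_LK u v (x : G u v) : cancel (fs_L x) (fs_Linv x).
Proof.
move=> n; apply: fibre_inj => /=.
by rewrite -!compA compVx compx1 compVK.
Qed.

Lemma fs_LinvK u v (x : G u v) : cancel (fs_Linv x) (fs_L x).
Proof.
move=> n; apply: fibre_inj => /=.
by rewrite -!compA compxV compx1 compKV.
Qed.

Lemma fs_LM u v (x : G u v) : {morph fs_L x : n m / (n * m)%g}.
Proof.
by move=> n m; apply: fibre_inj => /=; rewrite -!compA compVK.
Qed.

Lemma fs_L1 u v (x : G u v) : fs_L x 1%g = 1%g.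
Proof. by apply: fibre_inj => /=; rewrite compx1 compxV. Qed.

Lemma fs_LinvM u v (x : G u v) : {morph fs_Linv x : n m / (n * m)%g}.
Proof. by move=> n m; apply: (can_inj (fs_LK x)); rewrite fs_LM !fs_LinvK. Qed.

Lemma fs_sigmaP u v w (x : G u v) (y : G v w) :
  ext_map j (comp (comp (sec k x) (sec k y)) (ginv (sec k (comp x y)))) = gid u.
Proof. by rewrite !ext_comp ext_ginv !secK compxV. Qed.

Definition fs_sigma u v w (x : G u v) (y : G v w) : fibre j u :=
  Fibre (fs_sigmaP x y).

Lemma fs_sigma_spec u v w (x : G u v) (y : G v w) :
  comp (sec k x) (sec k y) = comp (fs_sigma x y) (sec k (comp x y)).
Proof. by rewrite /= -compA compVx compx1. Qed.

End FactorSystem.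

(* The finitely supported elements of the product of the V x. *)
Record fsupp (T : Type) (V : T -> zmodType) := FSupp {
  fsupp_val :> forall x, V x;
  fsuppP : finite_set [set x | fsupp_val x <> 0] }.

Section FSuppZmod.
Variables (T : Type) (V : T -> zmodType).
Implicit Types f g h : fsupp V.

Lemma fsupp_eq f g : (forall x, f x = g x) -> f = g.
Proof.
case: f g => [f hf] [g hg] /= e.
have {}e := functional_extensionality_dep e; subst g.
by congr FSupp; exact: Prop_irrelevance.
Qed.

Lemma fsupp0_subproof : finite_set [set x | (0 : V x) <> 0].
Proof. by apply: (sub_finite_set _ (@finite_set0 T)) => x /=. Qed.

Lemma fsuppN_subproof f : finite_set [set x | - f x <> 0].
Proof.
by apply: sub_finite_set (fsuppP f) => x /= h e; apply: h; rewrite e oppr0.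
Qed.

Lemma fsuppD_subproof f g : finite_set [set x | f x + g x <> 0].
Proof.
have : finite_set ([set x | f x <> 0] `|` [set x | g x <> 0]).
  by rewrite finite_setU; split; apply: fsuppP.
apply: sub_finite_set => x /= h.
by have [e|] := pselect (f x = 0); [right => e'; apply: h; rewrite e e' addr0|left].
Qed.

Definition fsupp0 := FSupp fsupp0_subproof.
Definition fsuppN f := FSupp (fsuppN_subproof f).
Definition fsuppD f g := FSupp (fsuppD_subproof f g).

Lemma fsuppDA : associative fsuppD.
Proof. by move=> f g h; apply: fsupp_eq => x; apply: addrA. Qed.

Lemma fsuppDC : commutative fsuppD.
Proof. by move=> f g; apply: fsupp_eq => x; apply: addrC. Qed.

Lemma fsupp0D : left_id fsupp0 fsuppD.
Proof. by move=> f; apply: fsupp_eq => x; apply: add0r. Qed.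

Lemma fsuppND : left_inverse fsupp0 fsuppN fsuppD.
Proof. by move=> f; apply: fsupp_eq => x; apply: addNr. Qed.

HB.instance Definition _ := gen_eqMixin (fsupp V).
HB.instance Definition _ := gen_choiceMixin (fsupp V).
HB.instance Definition _ :=
  GRing.isZmodule.Build (fsupp V) fsuppDA fsuppDC fsupp0D fsuppND.

End FSuppZmod.

Lemma fsum_seq (V : zmodType) (T : choiceType) (A : set T) (r : seq T)
    (f : T -> V) : uniq r -> [set` r] `<=` A ->
    (forall i, A i -> i \notin r -> f i = 0) ->
  \sum_(i \in A) f i = \sum_(i <- r) f i.
Proof.
move=> ur rA f0; rewrite (fsbigE r) // big_mkcond; apply: eq_big_seq => i ir.
by rewrite mem_set //; apply: rA.
Qed.

Section GroupRing.
Variables (R : pzRingType) (H : groupType).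

Definition group_ring := fsupp (fun _ : H => R : zmodType).
HB.instance Definition _ := GRing.Zmodule.on group_ring.

Implicit Types f g h : group_ring.

Definition group_ring_conv (f g : H -> R) (z : H) : R :=
  \sum_(p \in [set p : H * H | (p.1 * p.2)%g = z]) f p.1 * g p.2.

Lemma group_ring_mul_subproof f g :
  finite_set [set z | group_ring_conv f g z <> 0].
Proof.
have := finite_image2 (fun x y : H => (x * y)%g) (fsuppP f) (fsuppP g).
apply: sub_finite_set => z /= nz; apply: contrapT => h; apply: nz.
apply: fsbig1 => -[x y] /= xy; apply: contrapT => nz; apply: h.
exists x; first by move=> e; apply: nz; rewrite e mul0r.
by exists y => // e; apply: nz; rewrite e mulr0.
Qed.

Definition group_ring_mul f g : group_ring := FSupp (group_ring_mul_subproof f g).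

Lemma group_ring_delta_subproof (a : H) :
  finite_set [set x | (x == a)%:R <> 0 :> R].
Proof.
apply: (sub_finite_set _ (finite_set1 a)) => x /=.
by case: eqP.
Qed.

Definition delta (a : H) : group_ring := FSupp (group_ring_delta_subproof a).

Lemma group_ring_convE (f g : H -> R) (X Y : seq H) (z : H) : uniq X -> uniq Y ->
    (forall x, x \notin X -> f x = 0) -> (forall y, y \notin Y -> g y = 0) ->
  group_ring_conv f g z =
    \sum_(x <- X) \sum_(y <- Y) if (x * y)%g == z then f x * g y else 0.
Proof.
move=> uX uY fX gY.
pose r := [seq p <- [seq (x, y) | x <- X, y <- Y] | (p.1 * p.2)%g == z].
rewrite /group_ring_conv (@fsum_seq _ _ _ r).
- by rewrite big_filter big_mkcond big_allpairs.
- by rewrite filter_uniq // allpairs_uniq // => -[x y] [x' y'].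
- by move=> [x y]; rewrite /= mem_filter => /andP[/eqP].
move=> [x y] /= xy; rewrite mem_filter /= xy eqxx /= => nr.
have [xX|/fX ->] := boolP (x \in X); last by rewrite mul0r.
have [yY|/gY ->] := boolP (y \in Y); last by rewrite mulr0.
by case/negP: nr; apply/allpairsP; exists (x, y).
Qed.

Lemma fsupp_seq f (g : group_ring) h : exists X : seq H,
  [/\ uniq X, (forall x, x \notin X -> f x = 0),
    (forall x, x \notin X -> g x = 0) & forall x, x \notin X -> h x = 0].
Proof.
have : finite_set ([set x | f x <> 0] `|` [set x | g x <> 0] `|` [set x | h x <> 0]).
  by rewrite !finite_setU; split; [split|]; apply: fsuppP.
move=> /finite_seqP[s es]; exists (undup s); rewrite undup_uniq.
by split=> // x; rewrite mem_undup; apply: contraNeq => /eqP nz;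
  have : [set` s] x by rewrite -es /=; tauto.
Qed.

Lemma group_ring_mulDl : left_distributive group_ring_mul +%R.
Proof.
move=> f g h; apply: fsupp_eq => z; rewrite /= /group_ring_mul.
have [X [uX fX gX hX]] := fsupp_seq f g h.
rewrite /= !(group_ring_convE _ uX uX) //; last by move=> x xX; rewrite /= fX ?gX ?addr0.
rewrite -big_split; apply: eq_bigr => x _; rewrite -big_split; apply: eq_bigr => y _ /=.
by case: eqP => _; rewrite ?addr0 ?mulrDl.
Qed.

Lemma group_ring_mulDr : right_distributive group_ring_mul +%R.
Proof.
move=> f g h; apply: fsupp_eq => z; rewrite /= /group_ring_mul.
have [X [uX fX gX hX]] := fsupp_seq f g h.
rewrite /= !(group_ring_convE _ uX uX) //; last by move=> x xX; rewrite /= gX ?hX ?addr0.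
rewrite -big_split; apply: eq_bigr => x _; rewrite -big_split; apply: eq_bigr => y _ /=.
by case: eqP => _; rewrite ?addr0 ?mulrDr.
Qed.

Lemma group_ring_mul1 : left_id (delta 1%g) group_ring_mul.
Proof.
move=> f; apply: fsupp_eq => z; rewrite /= /group_ring_conv.
rewrite (@fsum_seq _ _ _ [:: (1%g, z)]) //=.
- by rewrite big_seq1 /= eqxx mul1r.
- by move=> p; rewrite /= inE => /eqP -> /=; rewrite mul1g.
move=> [x y] /= xy; rewrite inE; case: (x =P 1%g) xy => [->|] /=; last by rewrite mul0r.
by rewrite mul1g => ->; rewrite eqxx.
Qed.

Lemma group_ring_mulr1 : right_id (delta 1%g) group_ring_mul.
Proof.
move=> f; apply: fsupp_eq => z; rewrite /= /group_ring_conv.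
rewrite (@fsum_seq _ _ _ [:: (z, 1%g)]) //=.
- by rewrite big_seq1 /= eqxx mulr1.
- by move=> p; rewrite /= inE => /eqP -> /=; rewrite mulg1.
move=> [x y] /= xy; rewrite inE; case: (y =P 1%g) xy => [->|] /=; last by rewrite mulr0.
by rewrite mulg1 => ->; rewrite eqxx.
Qed.

Lemma group_ring_mulA : associative group_ring_mul.
Proof.
move=> f g h; apply: fsupp_eq => z.
have [X [uX fX gX hX]] := fsupp_seq f g h.
have prod0 (f' g' : group_ring) (t : H) : (forall x, x \notin X -> f' x = 0) ->
    (forall x, x \notin X -> g' x = 0) ->
    t \notin undup [seq (x * y)%g | x <- X, y <- X] -> group_ring_mul f' g' t = 0.
  move=> fX' gX'; rewrite mem_undup => ht; rewrite /= (group_ring_convE _ uX uX) //.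
  rewrite big_seq big1 // => x xX; rewrite big_seq big1 // => y yX.
  by case: eqP => // xy; case/negP: ht; rewrite -xy; apply: allpairs_f.
set XX := undup _ in prod0; have uXX : uniq XX by apply: undup_uniq.
have inXX x y : x \in X -> y \in X -> (x * y)%g \in XX.
  by move=> xX yX; rewrite mem_undup; apply: allpairs_f.
have lhs : group_ring_mul f (group_ring_mul g h) z = \sum_(a <- X) \sum_(b <- X)
    \sum_(c <- X) if (a * (b * c))%g == z then f a * (g b * h c) else 0.
  rewrite [LHS](group_ring_convE _ uX uXX) //; last by move=> t; exact: prod0.
  apply: eq_bigr => a _.
  under eq_bigr => t _ do rewrite /= (group_ring_convE _ uX uX) //.
  transitivity (\sum_(t <- XX) \sum_(b <- X) \sum_(c <- X)
      if (b * c)%g == t then if (a * t)%g == z then f a * (g b * h c) else 0 else 0).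
    apply: eq_bigr => t _; case: eqP => _.
      rewrite big_distrr; apply: eq_bigr => b _; rewrite big_distrr.
      by apply: eq_bigr => c _ /=; case: eqP => _; rewrite ?mulr0.
    by rewrite big1 // => b _; rewrite big1 // => c _; case: eqP.
  rewrite exchange_big; apply: eq_big_seq => b bX; rewrite exchange_big.
  apply: eq_big_seq => c cX.
  rewrite (bigD1_seq (b * c)%g) ?inXX //= eqxx big1 ?addr0 // => t.
  by rewrite eq_sym => /negPf ->.
have rhs : group_ring_mul (group_ring_mul f g) h z = \sum_(a <- X) \sum_(b <- X)
    \sum_(c <- X) if ((a * b) * c)%g == z then f a * g b * h c else 0.
  rewrite [LHS](group_ring_convE _ uXX uX) //; last by move=> t; exact: prod0.
  under eq_bigr => t _ do under eq_bigr => c _ do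
    rewrite /= (group_ring_convE _ uX uX) //.
  transitivity (\sum_(t <- XX) \sum_(c <- X) \sum_(a <- X) \sum_(b <- X)
      if (a * b)%g == t then if (t * c)%g == z then f a * g b * h c else 0 else 0).
    apply: eq_bigr => t _; apply: eq_bigr => c _; case: eqP => _.
      rewrite big_distrl; apply: eq_bigr => a _; rewrite big_distrl.
      by apply: eq_bigr => b _ /=; case: eqP => _; rewrite ?mul0r.
    by rewrite big1 // => b _; rewrite big1 // => a _; case: eqP.
  under eq_bigr => t _ do rewrite exchange_big.
  rewrite exchange_big; apply: eq_big_seq => a aX.
  under eq_bigr => t _ do rewrite exchange_big.
  rewrite exchange_big; apply: eq_big_seq => b bX; rewrite exchange_big.
  apply: eq_big_seq => c cX.
  rewrite (bigD1_seq (a * b)%g) ?inXX //= eqxx big1 ?addr0 // => t.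
  by rewrite eq_sym => /negPf ->.
rewrite lhs rhs; apply: eq_bigr => a _; apply: eq_bigr => b _; apply: eq_bigr => c _.
by rewrite mulgA mulrA.
Qed.

HB.instance Definition _ := GRing.Zmodule_isPzRing.Build group_ring
  group_ring_mulA group_ring_mul1 group_ring_mulr1
  group_ring_mulDl group_ring_mulDr.

End GroupRing.

Section GroupRingTheory.
Variables (R : pzRingType) (H : groupType).
Implicit Types f g : group_ring R H.

Lemma group_ringME f g z :
  (f * g) z = \sum_(p \in [set p : H * H | (p.1 * p.2)%g = z]) f p.1 * g p.2.
Proof. by []. Qed.

Lemma delta1 : delta R (1%g : H) = 1. Proof. by []. Qed.

Lemma deltaM (a b : H) : delta R (a * b)%g = delta R a * delta R b.
Proof.
apply: fsupp_eq => z; rewrite group_ringME.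
rewrite (@fsum_seq _ _ _ (if z == (a * b)%g then [:: (a, b)] else [::])) /=.
- by case: eqP => _; rewrite ?big_seq1 ?big_nil //= !eqxx mulr1.
- by case: ifP.
- by move=> p /=; case: eqP => // ->; rewrite inE => /eqP ->.
move=> [x y] /= xy; case: (x =P a) => [xa|]; last by rewrite mul0r.
case: (y =P b) => [yb|]; last by rewrite mulr0.
by rewrite -xy xa yb eqxx mem_seq1 eqxx.
Qed.

End GroupRingTheory.

Section RingFactorSystem.
Variables (U : Type) (E G : groupoid U) (j : groupoid_extension E G).
Variables (k : normalized_section j) (R : pzRingType).

Section AtArrow.
Variables (u v : U) (x : G u v).
Implicit Types f g : group_ring R (fibre j v).

Lemma fs_M_subproof f : finite_set [set n | f (fs_Linv k x n) <> 0].
Proof.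
apply: sub_finite_set (finite_image (fs_L k x) (fsuppP f)) => n /= nz.
by exists (fs_Linv k x n) => //; rewrite fs_LinvK.
Qed.

Definition fs_M f : group_ring R (fibre j u) := FSupp (fs_M_subproof f).

Lemma fs_M_is_zmod_morphism : zmod_morphism fs_M.
Proof. by move=> f g; apply: fsupp_eq. Qed.

Lemma fs_M_is_monoid_morphism : monoid_morphism fs_M.
Proof.
split=> [|f g]; apply: fsupp_eq => n /=.
  by rewrite (can2_eq (fs_LinvK k x) (fs_LK k x)) fs_L1.
rewrite /group_ring_conv.
apply: (reindex_fsbig (fun p => (fs_Linv k x p.1, fs_Linv k x p.2))).
split=> [[a b] /= <-|[a b] [a' b'] _ _ /pair_equal_spec[ea eb]|[a b] /= ab].
- by rewrite fs_LinvM.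
- by congr pair; [exact: can_inj (fs_LinvK k x) _ _ ea
                 |exact: can_inj (fs_LinvK k x) _ _ eb].
exists (fs_L k x a, fs_L k x b); last by rewrite /= !fs_LK.
by rewrite /= -fs_LM ab fs_LinvK.
Qed.

HB.instance Definition _ := GRing.isZmodMorphism.Build _ _ fs_M
  fs_M_is_zmod_morphism.
HB.instance Definition _ := GRing.isMonoidMorphism.Build _ _ fs_M
  fs_M_is_monoid_morphism.

Definition fs_Mr : {rmorphism group_ring R (fibre j v) ->
    group_ring R (fibre j u)} := fs_M.

End AtArrow.

Definition fs_tau u v w (x : G u v) (y : G v w) : group_ring R (fibre j u) :=
  delta R (fs_sigma k x y).

Lemma fs_tau_unit u v w (x : G u v) (y : G v w) :
  fs_tau x y * delta R (fs_sigma k x y)^-1%g = 1 /\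
  delta R (fs_sigma k x y)^-1%g * fs_tau x y = 1.
Proof. by rewrite -!deltaM mulgV mulVg delta1. Qed.

End RingFactorSystem.

Section ArrowProduct.
Variables (U : Type) (G : groupoid U).

Definition arrow_mul (x y : arrow G) : arrow G :=
  match pselect (source x = range y) with
  | left e => Arrow (comp (ecast v (G (range x) v) e (arrow_hom x)) (arrow_hom y))
  | right _ => x
  end.

Lemma arrow_mulE u v w (x : G u v) (y : G v w) :
  arrow_mul (Arrow x) (Arrow y) = Arrow (comp x y).
Proof.
rewrite /arrow_mul; case: pselect => [e|/(_ erefl)//].
by rewrite (Prop_irrelevance e erefl).
Qed.

(* Finiteness of the support of a product, for any coefficients that vanish
   when one of their arguments does. *)
Lemma finite_product_supp (V W V' : arrow G -> zmodType) (f : fsupp V)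
    (g : fsupp W) (c : forall z : arrow G,
      {v : U & (G (range z) v * G v (source z))%type} -> V' z) :
  (forall z p, f (Arrow (projT2 p).1) = 0 -> c z p = 0) ->
  (forall z p, g (Arrow (projT2 p).2) = 0 -> c z p = 0) ->
  finite_set [set z | \sum_(p \in factorizations (arrow_hom z)) c z p <> 0].
Proof.
move=> cf cg; have := finite_image2 arrow_mul (fsuppP f) (fsuppP g).
apply: sub_finite_set => -[u w z] /= nz; apply: contrapT => h; apply: nz.
apply: fsbig1 => -[v [x y]] /= xy; apply: contrapT => nz; apply: h.
exists (Arrow x); first by move=> e; apply/nz/cf.
exists (Arrow y); first by move=> e; apply/nz/cg.
by rewrite arrow_mulE xy.
Qed.

End ArrowProduct.

Section GroupoidRing.
Variables (R : pzRingType) (U : Type) (E : groupoid U).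

Definition groupoid_ring := fsupp (fun _ : arrow E => R : zmodType).
HB.instance Definition _ := GRing.Zmodule.on groupoid_ring.

Implicit Types f g : groupoid_ring.

Lemma groupoid_ring_mul_subproof f g : finite_set [set z : arrow E |
  \sum_(p \in factorizations (arrow_hom z))
     f (Arrow (projT2 p).1) * g (Arrow (projT2 p).2) <> 0].
Proof.
by apply: (finite_product_supp (f := f) (g := g) (V' := fun=> R : zmodType))
  => z p ->; rewrite ?mul0r ?mulr0.
Qed.

Definition groupoid_ring_mul f g : groupoid_ring :=
  FSupp (groupoid_ring_mul_subproof f g).

End GroupoidRing.

(* Only the multiplication below depends on M and tau, which nevertheless are
   parameters of the type, so that it determines the multiplication. *)
Definition crossed_product (U : Type) (G : groupoid U) (A : U -> pzRingType)
    (M : forall u v, G u v -> {rmorphism A v -> A u})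
    (tau : forall u v w, G u v -> G v w -> A u) :=
  fsupp (fun x : arrow G => A (range x) : zmodType).

Section CrossedProduct.
Variables (U : Type) (G : groupoid U) (A : U -> pzRingType).
Variable M : forall u v, G u v -> {rmorphism A v -> A u}.
Variable tau : forall u v w, G u v -> G v w -> A u.

HB.instance Definition _ := GRing.Zmodule.on (crossed_product M tau).

Implicit Types f g : crossed_product M tau.

Lemma crossed_product_mul_subproof f g : finite_set [set z : arrow G |
  \sum_(p \in factorizations (arrow_hom z))
     (f (Arrow (projT2 p).1) * M (projT2 p).1 (g (Arrow (projT2 p).2))
       * tau (projT2 p).1 (projT2 p).2 : A (range z)) <> 0].
Proof.
apply: (finite_product_supp (f := f) (g := g)
  (V' := fun z : arrow G => A (range z) : zmodType)) => z p /= ->.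
  by rewrite !mul0r.
by rewrite rmorph0 mulr0 mul0r.
Qed.

Definition crossed_product_mul f g : crossed_product M tau :=
  FSupp (crossed_product_mul_subproof f g).

End CrossedProduct.

(* Main.v *)
From HB Require Import structures.
From Pilot Require Import Defs.
From mathcomp Require Import all_boot all_algebra.
From mathcomp Require Import all_classical.

Set Implicit Arguments.
Unset Strict Implicit.
Unset Printing Implicit Defensive.

Import Pilot.Defs GRing.Theory.
Local Open Scope classical_set_scope.
Local Open Scope ring_scope.

(** Every arrow of E is uniquely [n k(x)] with [x] in G and [n] in the fibre
    [N_(r(x))]: necessarily [x = j(e)] and [n = e k(j(e))^-1].  Hence a finitely
    supported function on E is the same thing as a finitely supported family of
    finitely supported functions on the fibres, indexed by the arrows of G, and
    the isomorphism is [phi(f)(n k(x)) = f(x)(n)].  It is visibly bijective and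
    additive.

    Multiplicativity compares two sums.  The value of [phi(f) phi(g)] at [e] is a
    sum over the factorizations [e = a b] in E; it is grouped by the image
    [(x, y) = (j(a), j(b))], which runs over the factorizations of [j(e)] in G
    ([fsum_fibres]).  The value of [phi(f g)] at [e] is a sum over the same pairs
    [(x, y)] of group ring elements [f(x) M_x(g(y)) tau(x, y)], evaluated at
    [e k(j(e))^-1].  For fixed [(x, y)] the latter is the sum of
    [f(x)(p) g(y)(L_x^-1(q))] over the pairs [(p, q)] of fibre elements with
    [p q = e k(j(e))^-1 sigma(x, y)^-1] ([crossed_termE]).  Since
    [[
      p k(x) L_x^-1(q) k(y) = p q k(x) k(y) = p q sigma(x, y) k(x y),
    ]]
    sending [(p, q)] to [(p k(x), L_x^-1(q) k(y))] is a bijection from these pairs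
    onto the factorizations of [e] that lie over [(x, y)] ([lift_pair_bij]), and it
    matches the two sums term by term. *)

(** * Finitely supported sums *)

(** A sum over [\in] is by convention zero when its support is infinite, so
    additivity and regrouping hold in general only for finite supports; this turns such
    a sum, through [fsum_seq], into one over a duplicate-free list. *)
Lemma enum_fsupport (V : zmodType) (I : choiceType) (A : set I) (F : I -> V) :
    finite_set [set i | F i <> 0] -> exists s : seq I,
  [/\ uniq s, [set` s] `<=` A & forall i, A i -> i \notin s -> F i = 0].
Proof.
move=> /(sub_finite_set (@subIsetr _ A _))/finite_seqP[s es].
exists (undup s); split=> [|i|i Ai]; first exact: undup_uniq.
  by rewrite /= mem_undup => si; have : [set` s] i by []; rewrite -es => -[].
rewrite mem_undup => /negP ns; apply: contrapT => nz; apply: ns.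
by change ([set` s] i); rewrite -es.
Qed.

Lemma raddf_fsum (V W : zmodType) (f : {additive V -> W}) (I : choiceType)
    (A : set I) (F : I -> V) : finite_set [set i | F i <> 0] ->
  f (\sum_(i \in A) F i) = \sum_(i \in A) f (F i).
Proof.
move=> /(enum_fsupport A)[s [us sA F0]].
rewrite (fsum_seq us sA F0) raddf_sum (fsum_seq us sA) // => i Ai /(F0 i Ai) ->.
exact: raddf0.
Qed.

(** Regrouping a sum along the fibres of [h].  The fibres and [B] may be infinite:
    over the image of an enumeration of the support it is an exchange of two
    finite sums. *)
Lemma fsum_fibres (V : zmodType) (I J : choiceType) (A : set I) (B : set J)
    (h : I -> J) (F : I -> V) : finite_set [set i | F i <> 0] ->
    (forall i, A i -> B (h i)) ->
  \sum_(i \in A) F i = \sum_(j \in B) \sum_(i \in A `&` [set i | h i = j]) F i.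
Proof.
move=> /(enum_fsupport A)[s [us sA F0]] AB.
have inner j : \sum_(i \in A `&` [set i | h i = j]) F i = \sum_(i <- s | h i == j) F i.
  rewrite -[RHS]big_filter; apply: fsum_seq; first by rewrite filter_uniq.
    by move=> i /=; rewrite mem_filter => /andP[/eqP hi /sA].
  by move=> i [Ai /= hi]; rewrite mem_filter hi eqxx; apply: F0.
rewrite (fsum_seq us sA F0) (eq_fsbigr (fun j => \sum_(i <- s | h i == j) F i));
  last by move=> j _; exact: inner.
rewrite (@fsum_seq _ _ _ (undup (map h s))) ?undup_uniq //.
- under [RHS]eq_bigr => j _ do rewrite big_mkcond.
  rewrite [RHS]exchange_big; apply: eq_big_seq => i si /=.
  rewrite (bigD1_seq (h i)) ?undup_uniq ?mem_undup ?map_f //= eqxx big1 ?addr0 // => j.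
  by rewrite eq_sym => /negPf ->.
- by move=> j /=; rewrite mem_undup => /mapP[i /sA Ai ->]; apply: AB.
move=> j _; rewrite mem_undup => nj; rewrite big_seq_cond big1 // => i /andP[si /eqP hi].
by case/negP: nj; rewrite -hi map_f.
Qed.

(** * Pairs of composable arrows *)

(** Equal elements of the total space have homs equal up to transport along a
    loop at [(u, v)], and such loops are trivial because equality on [U] is
    classically decidable. *)
Lemma Arrow_inj (U : Type) (G : groupoid U) u v : injective (@Arrow U G u v).
Proof.
move=> x y xy; pose T (p : ({classic U} * {classic U})%type) := G p.1 p.2.
apply: (@eq_from_Tagged _ T (u, v)).
exact: (congr1 (fun a : arrow G => Tagged T (i := (range a, source a)) (arrow_hom a)) xy).
Qed.

(** A composable pair is determined by its two arrows, so only finitely many pairs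
    have both arrows in the supports of [f] and [g].  This gives the finiteness
    that both sides of the multiplicativity identity need. *)
Lemma finite_composable_supp (U : Type) (G : groupoid U) (V W : arrow G -> zmodType)
    (V' : zmodType) (f : fsupp V) (g : fsupp W) (u w : U)
    (c : {classic {v : U & (G u v * G v w)%type}} -> V') :
    (forall p, f (Arrow (projT2 p).1) = 0 -> c p = 0) ->
    (forall p, g (Arrow (projT2 p).2) = 0 -> c p = 0) ->
  finite_set [set p | c p <> 0].
Proof.
move=> cf cg.
pose h (p : {classic {v : U & (G u v * G v w)%type}}) :=
  (Arrow (projT2 p).1, Arrow (projT2 p).2).
have hI : injective h.
  move=> [v [x y]] [v' [x' y']] /pair_equal_spec[/= ex ey].
  have ev := congr1 (@source U G) ex; rewrite /= in ev; subst v'.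
  by rewrite (Arrow_inj ex) (Arrow_inj ey).
have := finite_preimage (f := h) _ (finite_setX (fsuppP f) (fsuppP g)).
move=> /(_ (fun x y _ _ => @hI x y)); apply: sub_finite_set => p /= nz.
by split=> /= e; apply: nz; [apply: cf|apply: cg].
Qed.

(** * Group rings *)

(** In [f * delta a] only the factorization [n = (n a^-1) a] contributes. *)
Lemma group_ring_mul_delta (R : pzRingType) (H : groupType) (f : group_ring R H)
    (a n : H) : (f * delta R a) n = f (n * a^-1)%g.
Proof.
rewrite group_ringME (@fsum_seq _ _ _ [:: (n * a^-1, a)%g]) //=.
- by rewrite big_seq1 /= eqxx mulr1.
- by move=> p /=; rewrite inE => /eqP -> /=; rewrite mulgVK.
move=> [x y] /= <-; rewrite inE; case: (y =P a) => [->|] /=; last by rewrite mulr0.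
by rewrite mulgK eqxx.
Qed.

(** Evaluation is named so that it can carry an additive structure, which lets it
    be exchanged with the sum over factorizations in the crossed product. *)
Definition group_ring_eval (R : pzRingType) (H : groupType) (n : H)
  (f : group_ring R H) : R := f n.

Lemma group_ring_eval_is_zmod_morphism (R : pzRingType) (H : groupType) (n : H) :
  zmod_morphism (@group_ring_eval R H n).
Proof. by []. Qed.

HB.instance Definition _ (R : pzRingType) (H : groupType) (n : H) :=
  GRing.isZmodMorphism.Build (group_ring R H) R (@group_ring_eval R H n)
    (@group_ring_eval_is_zmod_morphism R H n).

(** * The isomorphism *)

Section Isomorphism.
Variables (U : Type) (E G : groupoid U) (j : groupoid_extension E G).
Variables (k : normalized_section j) (R : pzRingType).

Local Notation crossedR := (crossed_product (fs_Mr k R) (fs_tau k R)).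

Lemma bundle_partP u v (e : E u v) :
  ext_map j (comp e (ginv (sec k (ext_map j e)))) = gid u.
Proof. by rewrite ext_comp ext_ginv secK compxV. Qed.

Definition bundle_part u v (e : E u v) : fibre j u := Fibre (bundle_partP e).

Lemma bundle_partK u v (e : E u v) :
  comp (bundle_part e) (sec k (ext_map j e)) = e.
Proof. by rewrite /= -compA compVx compx1. Qed.

Lemma ext_map_mulsec u v (n : fibre j u) (x : G u v) :
  ext_map j (comp n (sec k x)) = x.
Proof. by rewrite ext_comp fibreP secK comp1x. Qed.

Lemma bundle_part_mulsec u v (n : fibre j u) (x : G u v) :
  bundle_part (comp n (sec k x)) = n.
Proof. by apply: fibre_inj; rewrite /= ext_map_mulsec -compA compxV compx1. Qed.

Lemma mulsecI u v (x : G u v) (n m : fibre j u) :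
  comp n (sec k x) = comp m (sec k x) -> n = m.
Proof. by move=> e; rewrite -(bundle_part_mulsec n x) e bundle_part_mulsec. Qed.

(** Uniqueness of the decomposition of an arrow of E; the existence is
    [bundle_partK]. *)
Lemma mulsec_unique u v (e : E u v) (n : fibre j u) (x : G u v) :
  e = comp n (sec k x) -> ext_map j e = x /\ bundle_part e = n.
Proof. by move=> ->; rewrite ext_map_mulsec bundle_part_mulsec. Qed.

(** The support lies in the finite union, over [x] in the support of [f], of the
    translates by [k(x)] of the finite supports of [f(x)]. *)
Lemma crossed_to_groupoid_supp (f : crossedR) : finite_set [set e : arrow E |
  f (Arrow (ext_map j (arrow_hom e))) (bundle_part (arrow_hom e)) <> 0].
Proof.
pose A (x : arrow G) : set (arrow E) :=
  (fun n : fibre j (range x) => Arrow (comp n (sec k (arrow_hom x))))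
    @` [set n | f x n <> 0].
have : finite_set (\bigcup_(x in [set x | f x <> 0]) A x).
  by apply: bigcup_finite => [|x _]; [|apply: finite_image]; apply: fsuppP.
apply: sub_finite_set => -[u v e] /= nz.
exists (Arrow (ext_map j e)) => /=; first by move=> f0; apply: nz; rewrite f0.
by exists (bundle_part e) => //=; rewrite -[in RHS](bundle_partK e).
Qed.

Definition crossed_to_groupoid (f : crossedR) : groupoid_ring R E :=
  FSupp (crossed_to_groupoid_supp f).

Lemma crossed_to_groupoid_mulsec (f : crossedR) u v (n : fibre j u) (x : G u v) :
  crossed_to_groupoid f (Arrow (comp n (sec k x))) = f (Arrow x) n.
Proof.
have [] := mulsec_unique (erefl (comp n (sec k x))).
by move=> /= ej en; rewrite en ej.
Qed.

Lemma bundle_coef_supp (g : groupoid_ring R E) (x : arrow G) :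
  finite_set [set n : fibre j (range x) |
    g (Arrow (comp n (sec k (arrow_hom x)))) <> 0].
Proof.
pose h (n : fibre j (range x)) := Arrow (comp n (sec k (arrow_hom x))).
apply: (finite_preimage (f := h)) (fsuppP g) => n m _ _ hnm.
exact: mulsecI (Arrow_inj hnm).
Qed.

Definition bundle_coef (g : groupoid_ring R E) (x : arrow G) :
  group_ring R (fibre j (range x)) := FSupp (@bundle_coef_supp g x).

Lemma groupoid_to_crossed_supp (g : groupoid_ring R E) :
  finite_set [set x | bundle_coef g x <> 0].
Proof.
apply: sub_finite_set
  (finite_image (fun e => Arrow (ext_map j (arrow_hom e))) (fsuppP g)).
move=> x /= nz; apply: contrapT => h; apply: nz; apply: fsupp_eq => n /=.
apply: contrapT => nz; apply: h; exists (Arrow (comp n (sec k (arrow_hom x)))) => //=.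
by rewrite ext_map_mulsec; case: x n nz.
Qed.

Definition groupoid_to_crossed (g : groupoid_ring R E) : crossedR :=
  FSupp (groupoid_to_crossed_supp g).

Lemma crossed_to_groupoidK : cancel crossed_to_groupoid groupoid_to_crossed.
Proof.
move=> f; apply: fsupp_eq => -[u v x]; apply: fsupp_eq => n.
exact: crossed_to_groupoid_mulsec.
Qed.

Lemma groupoid_to_crossedK : cancel groupoid_to_crossed crossed_to_groupoid.
Proof.
by move=> g; apply: fsupp_eq => -[u v e] /=; rewrite -[in RHS](bundle_partK e).
Qed.

Lemma crossed_to_groupoidD : {morph crossed_to_groupoid : f g / f + g}.
Proof. by move=> f g; apply: fsupp_eq. Qed.

Definition ext_pair u w (p : {classic {v : U & (E u v * E v w)%type}}) :
    {classic {v : U & (G u v * G v w)%type}} :=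
  existT _ (projT1 p) (ext_map j (projT2 p).1, ext_map j (projT2 p).2).

(** The factors [(p k(x), L_x^-1(q) k(y))]; conjugating [q] back to the fibre at the
    source of [x] makes the product of the factors begin with [p q]. *)
Definition lift_pair u v w (x : G u v) (y : G v w) (p : fibre j u * fibre j u) :
    {classic {v : U & (E u v * E v w)%type}} :=
  existT (fun v => (E u v * E v w)%type) v
    (comp p.1 (sec k x), comp (fs_Linv k x p.2) (sec k y)).

Lemma lift_pair_comp u v w (x : G u v) (y : G v w) (p : fibre j u * fibre j u) :
  comp (projT2 (lift_pair x y p)).1 (projT2 (lift_pair x y p)).2 =
  comp (p.1 * p.2 * fs_sigma k x y)%g (sec k (comp x y)).
Proof. by rewrite /= -!compA compVx compx1 compKV. Qed.

(** The two factors of a factorization of [e] over [(x, y)] decompose as [a = p k(x)]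
    and [b = n k(y)], which forces [q = L_x(n)]; comparing the fibre components of
    both sides of [lift_pair_comp] yields the constraint on [p q]. *)
Lemma lift_pair_bij u v w (x : G u v) (y : G v w) (e : E u w) :
    comp x y = ext_map j e ->
  set_bij [set p : fibre j u * fibre j u |
             (p.1 * p.2)%g = (bundle_part e * (fs_sigma k x y)^-1)%g]
    (factorizations e `&` [set p | ext_pair p =
       existT (fun v => (G u v * G v w)%type) v (x, y)]) (lift_pair x y).
Proof.
move=> xy; split.
- move=> p /= pe; split; last first.
    exact: (congr1 (existT _ v) (congr2 pair (ext_map_mulsec _ _) (ext_map_mulsec _ _))).
  by rewrite /factorizations /= lift_pair_comp pe mulgVK xy bundle_partK.
- move=> [a b] [a' b'] _ _ /(@eq_from_Tagged {classic U} (fun v => (E u v * E v w)%type)).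
  move=> /pair_equal_spec[/mulsecI ea /mulsecI eb].
  by congr pair; [exact: ea | exact: can_inj (fs_LinvK k x) _ _ eb].
move=> [v' [a b]] [/= ab /[dup] /(congr1 (@projT1 _ _)) /= ev].
(* Identifying the middle units first makes the arrow equalities homogeneous. *)
subst v'.
move=> /(@eq_from_Tagged {classic U} (fun v => (G u v * G v w)%type)).
move=> /pair_equal_spec[/= ex ey]; subst x y.
have eab : lift_pair (ext_map j a) (ext_map j b)
    (bundle_part a, fs_L k (ext_map j a) (bundle_part b)) = existT _ v (a, b).
  by rewrite /lift_pair [(_, _).1]/= [(_, _).2]/= fs_LK !bundle_partK.
exists (bundle_part a, fs_L k (ext_map j a) (bundle_part b)); last exact: eab.
have := lift_pair_comp (ext_map j a) (ext_map j b)
  (bundle_part a, fs_L k (ext_map j a) (bundle_part b)).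
rewrite eab xy => abE; have [_ eE] := mulsec_unique (etrans (esym ab) abE).
exact: canRL (mulgK _) (esym eE).
Qed.

(** One term of the crossed product.  Right multiplication by [tau(x, y)], a
    delta function, only shifts the argument, and [M_x] precomposes with [L_x^-1]. *)
Lemma crossed_termE u v w (x : G u v) (y : G v w)
    (f : group_ring R (fibre j u)) (g : group_ring R (fibre j v)) (n : fibre j u) :
  (f * fs_Mr k R x g * fs_tau k R x y) n =
    \sum_(p \in [set p : fibre j u * fibre j u |
                  (p.1 * p.2)%g = (n * (fs_sigma k x y)^-1)%g])
      f p.1 * g (fs_Linv k x p.2).
Proof. by rewrite /fs_tau group_ring_mul_delta. Qed.

Lemma crossed_to_groupoidM : {morph crossed_to_groupoid : f g /
  crossed_product_mul f g >-> groupoid_ring_mul f g}.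
Proof.
move=> f g; apply: fsupp_eq => -[u w e].
rewrite [RHS](@fsum_fibres _ _ _ _ (factorizations (ext_map j e)) (@ext_pair u w)).
- rewrite [LHS](raddf_fsum (@group_ring_eval R (fibre j u) (bundle_part e))).
  + apply: eq_fsbigr => -[v [x y]]; rewrite inE => /= xy.
    rewrite [RHS](reindex_fsbig _ _ _ _ (@lift_pair_bij u v w x y e xy)).
    apply: etrans (crossed_termE _ _ _ _ _) _.
    apply: eq_fsbigr => p _; apply: congr2; apply: esym;
      exact: crossed_to_groupoid_mulsec.
  apply: (finite_composable_supp (f := f) (g := g)) => p /= ->.
    by rewrite !mul0r.
  by rewrite rmorph0 mulr0 mul0r.
- by apply: (finite_composable_supp (f := crossed_to_groupoid f)
    (g := crossed_to_groupoid g)) => p /= ->; rewrite ?mul0r ?mulr0.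
by move=> [v [a b]] /= <-; rewrite /factorizations /= ext_comp.
Qed.

End Isomorphism.

Theorem corollary4p5 (U : Type) (E G : groupoid U)
    (j : groupoid_extension E G) (k : normalized_section j) (R : pzRingType) :
  exists phi : crossed_product (fs_Mr k R) (fs_tau k R) -> groupoid_ring R E,
    [/\ bijective phi,
        {morph phi : f g / f + g}
      & {morph phi : f g / crossed_product_mul f g >-> groupoid_ring_mul f g}].
Proof.
exists (@crossed_to_groupoid U E G j k R); split.
- exact: Bijective (@crossed_to_groupoidK U E G j k R) (@groupoid_to_crossedK U E G j k R).
- exact: crossed_to_groupoidD.
exact: crossed_to_groupoidM.
Qed.
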